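(* Let $q$ be a prime power and let $\mathbb{X}$ be an André hyper-regulus in $\mathrm{PG}(5,q)$; that is, $\mathbb{X}=\varphi(\mathbb{X}_f)$ for some collineation $\varphi$ of $\mathrm{PG}(5,q)$ and some $f\in\mathrm{GF}(q)\setminus\{0\}$, where (in the model described in the context) $\mathbb{X}_f=\{\pi_m^{(0)} : N(m)=f\}$, with switching sets $\mathbb{Y}=\varphi(\{\pi_m^{(1)} : N(m)=f\})$ and $\mathbb{Z}=\varphi(\{\pi_m^{(2)} : N(m)=f\})$. Then the planes of $\mathrm{PG}(5,q)$ that meet every plane of $\mathbb{X}$ in exactly one point are precisely the planes of $\mathbb{Y}\cup\mathbb{Z}$; in particular there are exactly $2(q^2+q+1)$ such planes.
   Context: Model $\mathrm{PG}(5,q)$ as the projective space of the $6$-dimensional $\mathrm{GF}(q)$-vector space $V=\mathrm{GF}(q^3)\times\mathrm{GF}(q^3)$; planes of $\mathrm{PG}(5,q)$ are $3$-dimensional $\mathrm{GF}(q)$-subspaces of $V$. $N(m)=m^{q^2+q+1}$ is the norm from $\mathrm{GF}(q^3)$ to $\mathrm{GF}(q)$. For $m\in\mathrm{GF}(q^3)\setminus\{0\}$ and $i\in\{0,1,2\}$ let $\pi_m^{(i)}=\{(x, m x^{q^i}) : x\in\mathrm{GF}(q^3)\}$, a plane of $\mathrm{PG}(5,q)$. For fixed $f$, each of the sets $\{\pi_m^{(i)}: N(m)=f\}$, $i=0,1,2$, consists of $q^2+q+1$ mutually disjoint planes, and two planes from different ones of these sets meet in exactly one point; the sets $\mathbb{Y},\mathbb{Z}$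 are called the switching sets of $\mathbb{X}$. *)

(* Defs.v *)
From HB Require Import structures.
From mathcomp Require Import all_boot all_order all_fingroup all_algebra all_field.
From mathcomp Require Import mathcomp_extra boolp classical_sets functions cardinality.

Set Implicit Arguments.
Unset Strict Implicit.
Unset Printing Implicit Defensive.

Import GRing.Theory.

Local Open Scope ring_scope.
Local Open Scope classical_set_scope.

Section ProjectiveSpace.
Variables (F : fieldType) (V : vectType F).
Implicit Types U W P : {vspace V}.

(* Projective subspaces of PG(V) are the vector subspaces of V; the empty
   projective subspace is the zero subspace. *)
Definition is_point P : Prop := \dim P = 1%N.
Definition is_plane U : Prop := \dim U = 3%N.

Definition meet_in_one_point U W : Prop :=
  exists! P, is_point P /\ (P <= U)%VS /\ (P <= W)%VS.

(* A collineation is taken on subspaces of all dimensions, as a bijection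
   preserving incidence (inclusion) in both directions; by the fundamental
   theorem of projective geometry it comes from a semilinear bijection when
   \dim V >= 3, but this is not built into the definition. *)
Definition collineation (phi : {vspace V} -> {vspace V}) : Prop :=
  bijective phi /\ {mono phi : U W / (U <= W)%VS}.

End ProjectiveSpace.

Section Andre.
Variables (F : finFieldType) (L : fieldExtType F).
Local Notation q := #|F|.

(* The norm from L = GF(q^3) to F = GF(q), with values taken in L. *)
Definition cubic_norm (m : L) : L := m ^+ (q ^ 2 + q + 1)%N.

Definition twist (i : nat) (m x : L) : L * L := (x, m * x ^+ (q ^ i)%N).

Fact twist_is_linear i m : linear (twist i m).
Proof.
have [p p_pr pcharFp] := finPcharP F.
have q_pnat : [pchar L].-nat (q ^ i)%N.
  have pcharLp : p \in [pchar L] by rewrite pchar_lalg.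
  rewrite (eq_pnat _ (pcharf_eq pcharLp)) pnatX; apply/orP; left.
  by rewrite (card_pprimeChar pcharFp) pnatX pnat_id.
have qF (a : F) : a ^+ (q ^ i)%N = a.
  by elim: i {q_pnat} => [|i IHi]; rewrite ?expr1 // expnS exprM expf_card.
move=> a x y; congr (_, _) => /=.
rewrite exprDn_pchar // exprZn qF mulrDr.
by rewrite -scalerAr.
Qed.

HB.instance Definition _ i m :=
  GRing.isLinear.Build F L (L * L)%type *:%R (twist i m) (twist_is_linear i m).

(* The plane {(x, m x^(q^i)) : x in L}. *)
Definition pi_plane (i : nat) (m : L) : {vspace L * L} :=
  (linfun (twist i m) @: fullv)%VS.

Lemma memv_pi_plane i m (v : L * L) :
  (v \in pi_plane i m) = (v.2 == m * v.1 ^+ (q ^ i)%N).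
Proof.
apply/memv_imgP/eqP => [[x _ ->]|]; first by rewrite lfunE.
by case: v => x y /= ->; exists x; rewrite ?memvf // lfunE.
Qed.

Definition andre_set (i : nat) (f : F) : set {vspace L * L} :=
  [set U | exists m : L, [/\ m != 0, cubic_norm m = f%:A & U = pi_plane i m]].

End Andre.

Arguments andre_set {F} L i f.

(* Main.v *)
(* A plane U meeting all q^2+q+1 planes y = m x with N(m) = f in one point each
   has all its points on them, by counting, so U is the graph of an F-linear
   map T on L.  Write T x = a x + b x^q + c x^(q^2).  As T - m is singular
   whenever N(m) = f, its Dickson determinant, in which m^(1+q+q^2) is replaced
   by f, is a polynomial in m of degree at most q^2+q with q^2+q+1 roots.  Its
   coefficients therefore vanish, which forces a = 0 and one of b, c to be 0,
   the other having norm f.  The converse is Hilbert 90.  Collineations preserve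
   dimensions, so it is enough to treat the model. *)
From HB Require Import structures.
Require Import Defs.
From mathcomp Require Import all_boot all_order all_fingroup all_algebra all_field.
From mathcomp Require Import mathcomp_extra boolp classical_sets functions cardinality.
From mathcomp Require Import finmap ring zify.

Set Implicit Arguments.
Unset Strict Implicit.
Unset Printing Implicit Defensive.

Import GRing.Theory.

Local Open Scope ring_scope.
Local Open Scope classical_set_scope.
Local Open Scope card_scope.

(** * Collineations, dimension and one-point intersections *)

Section Collineation.
Variables (F : fieldType) (V : vectType F).
Implicit Types (phi : {vspace V} -> {vspace V}) (U W P : {vspace V}).

Lemma collineation_inv phi : collineation phi ->
  exists psi, [/\ cancel phi psi, cancel psi phi & collineation psi].
Proof.
case=> -[psi phiK psiK] phi_mono; exists psi; split=> //; split.
  by exists phi.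
by move=> U W; rewrite -[LHS]phi_mono !psiK.
Qed.

(** Injectivity and monotonicity send a hyperplane [W] of [U] to a proper subspace of [phi U], so
    each unit of dimension of [U] costs at least one unit in the image. Applied to the inverse
    collineation as well, this gives equality. *)
Lemma collineation_leq_dim phi U : collineation phi -> (\dim U <= \dim (phi U))%N.
Proof.
case=> phi_bij phi_mono.
have: exists n, n = \dim U by exists (\dim U).
case=> n; elim: n U => [|n IHn] U dimU; first by rewrite -dimU.
have [v vU v0] : exists2 v, v \in U & v != 0.
  by exists (vpick U); rewrite ?memv_pick // vpick0 -dimv_eq0 -dimU.
pose W := (U :\: <[v]>)%VS.
have WU : (W <= U)%VS by exact: diffvSl.
have dimW : n = \dim W.
  have := dimv_cap_compl U <[v]>.
  have /capv_idPr -> : (<[v]> <= U)%VS by [].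
  by rewrite dim_vline v0 -dimU => -[].
have neWU : phi W != phi U.
  by apply/eqP => /(bij_inj phi_bij) eWU; move: dimW; rewrite eWU -dimU; lia.
rewrite -dimU (leq_ltn_trans (leq_trans _ (IHn _ dimW))) -?dimW //.
have /dimv_leqif_eq/ltn_leqif -> : (phi W <= phi U)%VS by rewrite phi_mono.
exact: neWU.
Qed.

Lemma collineation_dim phi U : collineation phi -> \dim (phi U) = \dim U.
Proof.
move=> phi_col; have [psi [phiK _ psi_col]] := collineation_inv phi_col.
apply/eqP; rewrite eqn_leq (collineation_leq_dim U phi_col) andbT.
by rewrite -{2}(phiK U) collineation_leq_dim.
Qed.

Lemma collineation_meet phi U W : collineation phi ->
  meet_in_one_point U W -> meet_in_one_point (phi U) (phi W).
Proof.
move=> phi_col [P [[dimP [PU PW]] Puniq]].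
have [psi [phiK psiK psi_col]] := collineation_inv phi_col.
have [_ phi_mono] := phi_col; have [_ psi_mono] := psi_col.
exists (phi P); split=> [|Q [dimQ [QU QW]]].
  by rewrite !phi_mono /is_point collineation_dim.
rewrite (Puniq (psi Q)) ?psiK //; split.
  by rewrite /is_point collineation_dim.
by rewrite -(phiK U) -(phiK W) !psi_mono.
Qed.

(** Every nonzero common vector spans a common point, so uniqueness of the point bounds the
    intersection from above. *)
Lemma meet_in_one_pointP U W :
  meet_in_one_point U W <-> \dim (U :&: W) = 1%N.
Proof.
split=> [[P [[dimP [PU PW]] Puniq]]|dimUW].
  apply/eqP; rewrite eqn_leq andbC -dimP dimvS ?subv_cap ?PU //=.
  apply: dimvS; apply/subvP => v; rewrite memv_cap => /andP[vU vW].
  have [->|v0] := eqVneq v 0; first exact: mem0v.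
  by rewrite (Puniq <[v]>%VS) ?memv_line // /is_point dim_vline v0.
exists (U :&: W)%VS; split=> [|P [dimP [PU PW]]].
  by rewrite /is_point dimUW capvSl capvSr.
by apply/eqP; rewrite eq_sym eqEdim subv_cap PU PW dimUW dimP.
Qed.

End Collineation.

(* With primes for x |-> x^q, the conclusion is the vanishing of the Dickson
   determinant of a x + b x^q + c x^(q^2) at a root x (y = x^q, z = x^(q^2)). *)
Lemma singular_circulant (K : fieldType) (a a' a'' b b' b'' c c' c'' x y z : K) :
    x != 0 -> a * x + b * y + c * z = 0 -> a' * y + b' * z + c' * x = 0 ->
    a'' * z + b'' * x + c'' * y = 0 ->
  a * a' * a'' + b * b' * b'' + c * c' * c''
    - (a * b' * c'' + a' * b'' * c + a'' * b * c') = 0.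
Proof.
move=> x0 e1 e2 e3; apply/(mulIf x0); rewrite mul0r.
(* Elimination of y and z: the multipliers are the cofactors of the column of x in the 3 by 3
   system. *)
have -> : 0 = (a * x + b * y + c * z) * (a' * a'' - b' * c'')
  - (a' * y + b' * z + c' * x) * (b * a'' - c * c'')
  + (a'' * z + b'' * x + c'' * y) * (b * b' - c * a') :> K.
  by rewrite e1 e2 e3 !mul0r subrr addr0.
by ring.
Qed.

Lemma size_polyD_leq (R : nzRingType) k (p r : {poly R}) :
  (size p <= k -> size r <= k -> size (p + r)%R <= k)%N.
Proof. by move=> sp sr; rewrite (leq_trans (size_polyD _ _)) // geq_max sp. Qed.

Lemma card_eq_seq (T : choiceType) (s : seq T) : uniq s -> [set` s] #= `I_(size s).
Proof.
move=> s_uniq; have -> : [set` s] = [set` [fset x in s]%fset].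
  by apply/seteqP; split=> x /=; rewrite inE.
by apply/card_eq_fsetP; rewrite card_fseq undup_id.
Qed.

(** * Frobenius powers and norm fibres in a cubic extension *)

Section Cubic.
Variables (F : finFieldType) (L : fieldExtType F).
Local Notation q := #|F|.

Lemma cubic_unit_order : ((q ^ 2 + q + 1) * q.-1).+1 = (q ^ 3)%N.
Proof. by have := finNzRing_gt1 F; case: q => // k _; rewrite !expnS expn0 /=; nia. Qed.

Lemma expr_cardX_pchar i : [pchar L].-nat (q ^ i)%N.
Proof.
have [p p_pr pcharFp] := finPcharP F.
have pcharLp : p \in [pchar L] by rewrite pchar_lalg.
rewrite (eq_pnat _ (pcharf_eq pcharLp)) pnatX; apply/orP; left.
by rewrite (card_pprimeChar pcharFp) pnatX pnat_id.
Qed.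

Lemma exprD_cardX i (x y : L) :
  (x + y) ^+ (q ^ i)%N = x ^+ (q ^ i)%N + y ^+ (q ^ i)%N.
Proof. exact/exprDn_pchar/expr_cardX_pchar. Qed.

Lemma exprB_cardX i (x y : L) :
  (x - y) ^+ (q ^ i)%N = x ^+ (q ^ i)%N - y ^+ (q ^ i)%N.
Proof. by apply/(addIr (y ^+ (q ^ i)%N)); rewrite -exprD_cardX !subrK. Qed.

Hypothesis dimL : \dim {:L} = 3%N.
Local Notation n := (q ^ 2 + q + 1)%N.

Lemma card_cubic : #|finvect_type L| = (q ^ 3)%N.
Proof.
rewrite -dimL -(card_vspace (fullv : {vspace finvect_type L})).
by apply: eq_card => v; rewrite (memvf (v : L)).
Qed.

Lemma expr_card_cubic (x : L) : x ^+ (q ^ 3)%N = x.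
Proof. by rewrite -card_cubic; exact: (@expf_card (FinFieldExtType L)). Qed.

(** Since u^j = 1, the binomial X^k - u divides X^(kj) - 1 and hence X^(q^3) - X, which is the
    product of X - x over all x in L. It is used with k = q^2+q+1 for norm fibres and with k = q-1
    for Hilbert 90. *)
Lemma binomial_roots k j (u : L) : (k * j).+1 = (q ^ 3)%N -> u ^+ j = 1 ->
  exists rs : seq L, [/\ uniq rs, size rs = k & forall x, (x \in rs) = (x ^+ k == u)].
Proof.
move=> kj uj.
have k0 : (0 < k)%N.
  case: k kj => // e; have := ltn_exp2l 0 3 (finNzRing_gt1 F).
  by rewrite -e mul0n ltnn.
have div : 'X^k - u%:P %| \prod_(x : FinFieldExtType L) ('X - x%:P).
  rewrite -finField_genPoly /= card_cubic -kj -[X in _ %| _ - X]mulr1.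
  rewrite exprS -mulrBr dvdp_mull // exprM.
  by rewrite -polyC1 -uj polyC_exp subrXX dvdp_mulIl.
have [m eqp] := dvdp_prod_XsubC div.
set rs := mask _ _ in eqp.
exists rs; split.
- exact/mask_uniq/index_enum_uniq.
- have := eqp_size eqp; rewrite size_prod_XsubC size_XnsubC //.
  by case.
move=> x; transitivity (root ('X^k - u%:P) x).
  exact: etrans (esym (root_prod_XsubC rs x)) (esym (eqp_root eqp x)).
by rewrite /root !hornerE subr_eq0.
Qed.

(** Over F the polynomial X^q - X already splits as the product of all X - a, so it gains no further
    roots in L. *)
Lemma alg_fixed (y : L) : y ^+ q = y -> exists a : F, y = a%:A.
Proof.
move=> yq; pose p : {poly F} := 'X^q - 'X.
have : root (map_poly (in_alg L) p) y.
  by rewrite rmorphB /= map_polyXn map_polyX /root !hornerE yq subrr.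
rewrite /p finField_genPoly rmorph_prod /root horner_prod prodf_seq_eq0.
case/hasP => a _ /=; rewrite map_polyXsubC hornerXsubC subr_eq0 => /eqP ->.
by exists a.
Qed.

Lemma expr_card_inj : injective (fun x : L => x ^+ q).
Proof.
move=> x y exy; rewrite -(expr_card_cubic x) -(expr_card_cubic y).
by rewrite !(expnS q 2) !exprM exy.
Qed.

Lemma cubic_normE (m : L) : cubic_norm m = m * m ^+ q * m ^+ (q ^ 2)%N.
Proof. by rewrite /cubic_norm addn1 exprS addnC exprD mulrA. Qed.

Lemma cubic_norm_fiber (f : F) : f != 0 ->
  exists rs : seq L, [/\ uniq rs, size rs = n &
    forall m, (m \in rs) = (cubic_norm m == f%:A)].
Proof.
move=> f0; apply: (binomial_roots cubic_unit_order).
rewrite -in_algE -rmorphXn /=.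
suff -> : f ^+ q.-1 = 1 by rewrite scale1r.
by apply: (mulfI f0); rewrite -exprS prednK ?expf_card ?mulr1 // ltnW ?finNzRing_gt1.
Qed.

(* Existence of a nonzero solution is Hilbert 90. *)
Lemma frobenius_eigenline (u : L) : u ^+ n = 1 ->
  exists2 x0 : L, x0 != 0 &
    forall x, x ^+ q = u * x <-> exists a : F, x = a *: x0.
Proof.
move=> un; have q1 : (1 < q)%N := finNzRing_gt1 F.
have := cubic_unit_order; rewrite mulnC => ho.
have u0 : u != 0 by apply: contra_eq_neq un => ->; rewrite expr0n addn1 eq_sym oner_neq0.
have [rs [_ srs mrs]] := binomial_roots ho un.
(* The polynomial X^(q-1) - u has q-1 > 0 roots in L because u has norm 1. *)
have [x0 /eqP x0u] : exists x0 : L, x0 ^+ q.-1 == u.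
  case: rs srs mrs => [|x0 rs] srs mrs; last first.
    by exists x0; rewrite -mrs mem_head.
  by move/esym/eqP: srs; rewrite -subn1 subn_eq0 leqNgt q1.
have x0n0 : x0 != 0.
  by apply: contraNneq u0 => x00; rewrite -x0u x00 expr0n; case: q q1 => [|[]].
have x0q : x0 ^+ q = u * x0 by rewrite -x0u -exprSr prednK // ltnW.
exists x0 => // x; split=> [xq|[a ->]]; last first.
  by rewrite exprZn x0q expf_card scalerAr.
(* The quotient of two solutions is fixed by x |-> x^q, so it lies in F. *)
have [|a ea] := @alg_fixed (x / x0).
  rewrite exprMn exprVn xq x0q invfM mulrACA divff // mul1r //.
by exists a; rewrite -mulr_algl -ea divfK.
Qed.

(** * Intersections of the planes of the model *)

Lemma dim_pi_plane i (m : L) : \dim (pi_plane i m) = 3%N.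
Proof.
rewrite -dimL limg_dim_eq //; apply/eqP; rewrite -subv0; apply/subvP => x.
rewrite memv_cap memv_ker lfunE memv0 => /andP[_].
by case/eqP => ->.
Qed.

(** Common vectors correspond to solutions of b x^(q^i) = m x. This becomes x^q = u x with u = m/b
    for i = 1 and, after taking q-th powers, u = (b/m)^q for i = 2. Equal norms make u of norm 1, so
    Hilbert 90 gives exactly an F-line of solutions. *)
Lemma dim_cap_pi_plane i (b m : L) : b != 0 -> cubic_norm b = cubic_norm m ->
  i \in [:: 1; 2]%N -> \dim (pi_plane i b :&: pi_plane 0 m) = 1%N.
Proof.
move=> b0 Nbm i12.
have m0 : m != 0.
  apply: contra_neq b0 => m0; move/eqP: Nbm.
  by rewrite m0 /cubic_norm expr0n addn1 expf_eq0 => /eqP.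
have [u un eig] : exists2 u, u ^+ n = 1 &
    forall x, b * x ^+ (q ^ i)%N = m * x <-> x ^+ q = u * x.
  have Nx (x y : L) : y != 0 -> cubic_norm x = cubic_norm y -> (x / y) ^+ n = 1.
    by move=> y0; rewrite exprMn exprVn /cubic_norm => ->; rewrite divff // expf_neq0.
  move: i12; rewrite !inE => /orP[] /eqP->.
    exists (m / b) => [|x]; first exact: Nx.
    rewrite expn1 -mulrAC; split=> [<-|->]; first by rewrite mulrAC mulfV // mul1r.
    by rewrite mulrC divfK.
  exists ((b / m) ^+ q) => [|x]; first by rewrite exprAC Nx // expr1n.
  have mq0 : m ^+ q != 0 by rewrite expf_neq0.
  have xq3 : (x ^+ (q ^ 2)%N) ^+ q = x by rewrite -exprM -expnSr expr_card_cubic.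
  rewrite exprMn exprVn mulrAC; split=> [/(congr1 (fun t => t ^+ q))|e].
    by rewrite !exprMn xq3 => ->; rewrite mulrAC mulfV // mul1r.
  by apply: expr_card_inj; rewrite /= !exprMn xq3 e [RHS]mulrC divfK.
have [x0 x0n0 line] := frobenius_eigenline un.
suff -> : (pi_plane i b :&: pi_plane 0 m)%VS = <[(x0, m * x0)%R]>%VS.
  by rewrite dim_vline xpair_eqE negb_and x0n0.
apply/vspaceP => -[x y]; rewrite memv_cap !memv_pi_plane /= expn0 expr1.
apply/andP/vlineP => [[/eqP-> /eqP/eig/line[a ->]]|[a [-> ->]]].
  exists a; congr (_, _); rewrite /= scalerAr.
  by apply/eig/line; exists a.
rewrite scalerAr; split=> //; rewrite eq_sym.
by apply/eqP/eig/line; exists a.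
Qed.

(** * Linearized polynomials and their eigenvalues *)

Definition linearized (w : L * (L * L)) : 'End(L) :=
  linfun (snd \o @twist F L 0 w.1) + linfun (snd \o @twist F L 1 w.2.1)
    + linfun (snd \o @twist F L 2 w.2.2).

Lemma linearizedE w x : linearized w x =
  w.1 * x + w.2.1 * x ^+ q + w.2.2 * x ^+ (q ^ 2)%N.
Proof. by rewrite !add_lfunE !lfunE /= expr1. Qed.

Fact linearized_is_linear : linear linearized.
Proof.
move=> k u v; apply/lfunP => x; rewrite linearizedE.
rewrite add_lfunE scale_lfunE !linearizedE /=.
rewrite !mulrDl !scalerDr -!scalerAl; ring.
Qed.

HB.instance Definition _ :=
  GRing.isLinear.Build F (L * (L * L))%type 'End(L) *:%R linearized linearized_is_linear.

(** A polynomial of degree at most q^2 that vanishes at all q^3 elements of L is zero, and the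
    exponents 1, q, q^2 are distinct. *)
Lemma linearized_eq0 w : linearized w = 0 -> w = 0.
Proof.
case: w => a [b c] /lfunP w0; have q1 : (1 < q)%N := finNzRing_gt1 F.
have q2 : (q.*2 <= q ^ 2)%N by rewrite -mul2n expnS expn1 leq_mul2r q1 orbT.
have q3 : (q ^ 2 < q ^ 3)%N by rewrite ltn_exp2l.
pose P : {poly L} := a *: 'X + b *: 'X^q + c *: 'X^(q ^ 2).
have P0 : P = 0.
  apply: (@roots_geq_poly_eq0 _ _ (enum (FinFieldExtType L))).
  - apply/allP => x _; have := w0 x; rewrite linearizedE zero_lfunE /=.
    by rewrite /root !hornerE => ->.
  - exact: enum_uniq.
  rewrite -cardT card_cubic (leq_trans _ q3) //.
  by rewrite !size_polyD_leq // (leq_trans (size_scale_leq _ _))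
    ?size_polyX ?size_polyXn //; lia.
have eqF (i j : nat) : i <> j -> (i == j) = false by move/eqP/negPf.
have := congr1 (fun p : {poly L} => p`_1) P0.
have := congr1 (fun p : {poly L} => p`_q) P0.
have := congr1 (fun p : {poly L} => p`_(q ^ 2)) P0.
rewrite !coefE !eqxx !eqF ?mulr1 ?mulr0 ?addr0 ?add0r; try lia.
by move=> -> -> ->.
Qed.

(** Coefficient triples and endomorphisms of L both form spaces of dimension 9 over F, so
    injectivity suffices. *)
Lemma linearized_surj (T : 'End(L)) : exists w, T = linearized w.
Proof.
pose Phi := linfun linearized.
have kerPhi : lker Phi = 0%VS.
  apply/eqP; rewrite -subv0; apply/subvP => w; rewrite memv_ker lfunE memv0 /=.
  by move/eqP/linearized_eq0/eqP.
have dim3 : dim L = 3%N by rewrite -dimvf dimL.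
have : limg Phi = fullv.
  apply/eqP; rewrite eqEdim subvf /= limg_dim_eq ?kerPhi ?capv0 // !dimvf /dim /= ?dim3.
  by have -> : dim (L * L)%type = (dim L + dim L)%N by []; rewrite dim3.
move=> imPhi; have := memvf T; rewrite -imPhi => /memv_imgP[w _ ->].
by exists w; rewrite lfunE.
Qed.

Lemma linearized_norm_eigenvalues (f : F) w : f != 0 ->
    (forall m, cubic_norm m = f%:A -> exists2 x, x != 0 & linearized w x = m * x) ->
  w.1 = 0 /\ (w.2.2 = 0 /\ cubic_norm w.2.1 = f%:A
           \/ w.2.1 = 0 /\ cubic_norm w.2.2 = f%:A).
Proof.
case: w => a [b c] f0 /= eigw; have q1 : (1 < q)%N := finNzRing_gt1 F.
have q2 : (q.*2 <= q ^ 2)%N by rewrite -mul2n expnS expn1 leq_mul2r q1 orbT.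
have [frob frobX] : exists frob : nat -> L -> L, forall i x, frob i x = x ^+ (q ^ i)%N.
  by exists (fun i x => x ^+ (q ^ i)%N).
pose a1 := frob 1%N a; pose a2 := frob 2%N a; pose b1 := frob 1%N b; pose b2 := frob 2%N b.
pose c1 := frob 1%N c; pose c2 := frob 2%N c.
(* [P] is the Dickson determinant of T - m as a polynomial in m, with m^(q^2+q+1) replaced by f; [K]
   is its constant term. *)
pose K := a * a1 * a2 + b * b1 * b2 + c * c1 * c2
  - (a * b1 * c2 + a1 * b2 * c + a2 * b * c1) - f%:A.
pose P : {poly L} := a *: 'X^(q ^ 2 + q) + a1 *: 'X^(q ^ 2 + 1) + a2 *: 'X^(q + 1)
  + (b * c1 - a * a1) *: 'X^(q ^ 2) + (b2 * c - a * a2) *: 'X^q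
  + (b1 * c2 - a1 * a2) *: 'X + K%:P.
have [rs [rs_uniq rs_size mem_rs]] := cubic_norm_fiber f0.
have P0 : P = 0.
  apply: (@roots_geq_poly_eq0 _ _ rs) => //; last first.
    rewrite rs_size !size_polyD_leq // ?(leq_trans (size_scale_leq _ _)) //
      ?size_polyX ?size_polyXn ?(leq_trans (size_polyC_leq1 _)) //; lia.
  apply/allP => m; rewrite mem_rs => /eqP Nm.
  have [x x0 wx] := eigw m Nm.
  rewrite linearizedE /= -(frobX 2%N) -[x ^+ q]/(x ^+ (q ^ 1)%N) -(frobX 1%N) in wx.
  have frobA i y z t : frob i ((y - z) * x + t) = (frob i y - frob i z) * frob i x + frob i t.
    by rewrite !frobX exprD_cardX exprMn exprB_cardX.
  have frobD i y z : frob i (y + z) = frob i y + frob i z by rewrite !frobX exprD_cardX.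
  have frobM i y z : frob i (y * z) = frob i y * frob i z by rewrite !frobX exprMn.
  have frobC i j y : frob i (frob j y) = frob (i + j) y by rewrite !frobX -exprM -expnD addnC.
  have frob3 y : frob 3%N y = y by rewrite !frobX expr_card_cubic.
  have frob4 y : frob 4%N y = frob 1%N y by rewrite -(frobC 1%N 3%N) frob3.
  (* The eigenvector equation and its images under x |-> x^q and x |-> x^(q^2) are the three rows
     for [singular_circulant]. *)
  have rel : (a - m) * x + (b * frob 1%N x + c * frob 2%N x) = 0.
    by rewrite mulrBl -wx; ring.
  have rel0 i : frob i 0 = 0 by rewrite !frobX expr0n expn_eq0 gtn_eqF ?(ltnW q1).
  have rel1 := congr1 (frob 1%N) rel; have rel2 := congr1 (frob 2%N) rel.
  rewrite frobA !frobD !frobM !frobC ?frob3 rel0 in rel1.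
  rewrite frobA !frobD !frobM !frobC ?frob4 ?frob3 rel0 in rel2.
  rewrite addrA in rel; rewrite addrA in rel1; rewrite addrA in rel2.
  have det := singular_circulant x0 rel rel1 rel2.
  rewrite cubic_normE in Nm.
  rewrite /root /P !hornerD !hornerZ !hornerXn hornerX hornerC !exprD !expr1 /K -Nm.
  apply/eqP; rewrite -[RHS]det.
  by rewrite -/a1 -/a2 -/b1 -/b2 -/c1 -/c2 !frobX expn1; ring.
have eqF (i j : nat) : i <> j -> (i == j) = false by move/eqP/negPf.
(* As q >= 2, the exponents in [P] are distinct; the leading one has coefficient a. *)
have := congr1 (fun p : {poly L} => p`_(q ^ 2 + q)) P0.
rewrite !coefE !eqxx !eqF ?mulr1 ?mulr0 ?addr0; try lia.
move=> a0; split=> //.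
have a10 : a1 = 0 by rewrite /a1 a0 !frobX expr0n expn_eq0 gtn_eqF ?(ltnW q1).
have a20 : a2 = 0 by rewrite /a2 a0 !frobX expr0n expn_eq0 gtn_eqF ?(ltnW q1).
(* With a = 0 the coefficient of X is b^q c^(q^2), so b or c vanishes; the constant term then gives
   the norm of the other. *)
have := congr1 (fun p : {poly L} => p`_1) P0.
rewrite !coefE !eqxx !eqF ?mulr1 ?mulr0 ?addr0 ?add0r; try lia.
rewrite a10 mul0r subr0 => /eqP; rewrite mulf_eq0 /b1 /c2 !frobX !expf_eq0 => bc0.
have := congr1 (fun p : {poly L} => p`_0) P0.
rewrite !coefE !eqxx !eqF ?mulr1 ?mulr0 ?addr0 ?add0r; try lia.
rewrite /K a0 a10 a20 !mul0r !add0r subr0 => /eqP; rewrite subr_eq0 => /eqP e.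
case/orP: bc0 => /andP[_ /eqP bc0]; [right|left]; split=> //;
  rewrite -e cubic_normE bc0; last first.
  by rewrite /b1 /b2 !frobX expn1 !mul0r addr0.
by rewrite /c1 /c2 !frobX expn1 !mul0r add0r.
Qed.

(** * Planes meeting every plane of the model hyper-regulus in a point *)

(* The norm fibre gives q^2+q+1 lines of U which share only 0, and these
   already contain all q^3-1 nonzero vectors of U. *)
Lemma transversal_fst_inj (f : F) (U : {vspace L * L}) : f != 0 -> \dim U = 3%N ->
    (forall m, cubic_norm m = f%:A -> \dim (U :&: pi_plane 0 m) = 1%N) ->
  forall w, w \in U -> w.1 = 0 -> w = 0.
Proof.
move=> f0 dimU meetU w wU w1; apply/eqP/negPn/negP => w0.
have [rs [rs_uniq rs_size mem_rs]] := cubic_norm_fiber f0.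
pose v m := vpick (U :&: pi_plane 0 m).
have vP m : m \in rs -> [/\ v m \in U, (v m).2 = m * (v m).1 & (v m).1 != 0].
  rewrite mem_rs => /eqP/meetU dim1.
  have := memv_pick (U :&: pi_plane 0 m); rewrite -/(v m) memv_cap memv_pi_plane.
  case/andP => vU; rewrite expn0 expr1 => /eqP v2; split=> //.
  have : v m != 0 by rewrite vpick0 -dimv_eq0 dim1.
  by apply: contra_neq => v1; rewrite [v m]surjective_pairing v2 v1 mulr0.
(* All nonzero multiples of the chosen generators: (q^2+q+1)(q-1) = q^3-1 vectors, each with nonzero
   first coordinate. *)
pose s := [seq a *: v m | m <- rs, a <- [seq a <- enum F | a != 0]].
have s_fst x : x \in s -> x.1 != 0.
  case/allpairsP => -[m a] /= []/vP[_ _ v1]; rewrite mem_filter => /andP[a0 _] -> /=.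
  by rewrite scaler_eq0 negb_or a0.
(* Together with 0 and [w] these are q^3+1 distinct vectors of U, one more than U has. *)
have s_uniq : uniq [:: 0, w & s].
  rewrite /= inE negb_or eq_sym w0 /=; apply/and3P; split.
  - by apply/negP => /s_fst; rewrite eqxx.
  - by apply/negP => /s_fst; rewrite w1 eqxx.
  apply: allpairs_uniq => //; first by rewrite filter_uniq ?enum_uniq.
  move=> [m a] [m' a'] /allpairsP[[m1 a1] /= [mrs ars [-> ->]]].
  move=> /allpairsP[[m2 a2] /= [mrs' ars' [-> ->]]] /= e.
  move: ars ars'; rewrite !mem_filter => /andP[a0 _] /andP[a0' _].
  have [_ v2 v1] := vP _ mrs; have [_ v2' v1'] := vP _ mrs'.
  have e1 := congr1 fst e; have e2 := congr1 snd e; rewrite /= in e1 e2.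
  (* The slope m is recovered as the quotient of the two coordinates. *)
  have em : m1 = m2.
    have av1 : a1 *: (v m1).1 != 0 by rewrite scaler_eq0 negb_or a0.
    apply: (mulIf av1); rewrite [in RHS]e1 -!scalerAr -v2' -e2 v2.
    by rewrite scalerAr.
  move: e1; rewrite em => /eqP; rewrite -subr_eq0 -scalerBl scaler_eq0.
  by rewrite (negPf v1') orbF subr_eq0 => /eqP ->.
have sU x : x \in [:: 0, w & s] -> x \in U.
  rewrite !inE => /or3P[/eqP->|/eqP->|]; rewrite ?mem0v //.
  by case/allpairsP => -[m a] /= []/vP[vU _ _] _ ->; rewrite memvZ.
have : (size (0%R :: w :: s) <= size (enum (U : {vspace finvect_type (L * L)%type})))%N.
  apply: (@uniq_leq_size (finvect_type (L * L)%type)) => //.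
  by move=> x /sU xU; rewrite mem_enum.
rewrite -cardE card_vspace dimU /= size_allpairs rs_size.
have -> : size [seq a <- enum F | a != 0] = q.-1.
  by rewrite size_filter -(cardC1 (0 : F)) cardE enumT size_filter.
by rewrite -cubic_unit_order ltnn.
Qed.

(** Injectivity of the first coordinate on U puts U on the graph of T = S h^-1. A nonzero vector of
    U on y = m x gives an eigenvector of T for m, so every m of norm f is an eigenvalue. *)
Lemma transversal_plane_twist (f : F) (U : {vspace L * L}) : f != 0 -> \dim U = 3%N ->
    (forall m, cubic_norm m = f%:A -> \dim (U :&: pi_plane 0 m) = 1%N) ->
  exists i b, [/\ i \in [:: 1; 2]%N, cubic_norm b = f%:A & U = pi_plane i b].
Proof.
move=> f0 dimU meetU; have fst0 := transversal_fst_inj f0 dimU meetU.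
pose h := linfun (fst \o @vsval _ _ U) : 'Hom(subvs_of U, L).
pose S := linfun (snd \o @vsval _ _ U) : 'Hom(subvs_of U, L).
have kerh : lker h == 0%VS.
  rewrite -subv0; apply/subvP => u; rewrite memv_ker lfunE memv0 /= => /eqP u1.
  by apply/eqP/val_inj/fst0; rewrite ?subvsP.
have [w eqw] := linearized_surj (S \o h^-1)%VF.
have graph v : v \in U -> v.2 = linearized w v.1.
  move=> vU; rewrite -eqw comp_lfunE.
  have -> : v.1 = h (vsproj U v) by rewrite lfunE /= vsprojK.
  by rewrite lker0_lfunK // lfunE /= vsprojK.
have [m mN|w1 wP] := @linearized_norm_eigenvalues f w f0.
  set v := vpick (U :&: pi_plane 0 m).
  have := memv_pick (U :&: pi_plane 0 m); rewrite -/v memv_cap memv_pi_plane.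
  case/andP => vU; rewrite expn0 expr1 => /eqP v2; exists v.1; last by rewrite -graph.
  have : v != 0 by rewrite vpick0 -dimv_eq0 meetU.
  by apply: contra_neq => /fst0 ->.
(* Inclusion of U in the twisted plane is enough, both having dimension 3. *)
have Utwist i b : (forall x, linearized w x = b * x ^+ (q ^ i)%N) -> U = pi_plane i b.
  move=> wE; apply/eqP; rewrite eqEdim dimU dim_pi_plane // leqnn andbT.
  by apply/subvP => v /graph v2; rewrite memv_pi_plane v2 wE.
case: wP => [[w3 Nw]|[w2 Nw]].
  exists 1%N, w.2.1; split=> //; apply: Utwist => x.
  by rewrite linearizedE w1 w3 !mul0r add0r addr0.
exists 2%N, w.2.2; split=> //; apply: Utwist => x.
by rewrite linearizedE w1 w2 !mul0r !add0r.
Qed.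

(** * Distinctness of the twisted planes *)

Lemma pi_plane_inj i : injective (@pi_plane F L i).
Proof.
move=> m m' e; have : (1, m) \in pi_plane i m by rewrite memv_pi_plane /= expr1n mulr1.
by rewrite e memv_pi_plane /= expr1n mulr1 => /eqP.
Qed.

(** Comparison at x = 1 gives m = m'; then x^q = x^(q^2), hence x = x^q, for all x, which would make
    L equal to F. *)
Lemma pi_plane1_neq2 (m m' : L) : m != 0 -> pi_plane 1 m <> pi_plane 2 m'.
Proof.
move=> m0 e; have em : m = m'.
  have : (1, m) \in pi_plane 1 m by rewrite memv_pi_plane /= expr1n mulr1.
  by rewrite e memv_pi_plane /= expr1n mulr1 => /eqP.
have fixq (x : L) : x ^+ q = x.
  have : (x, m * x ^+ q) \in pi_plane 1 m by rewrite memv_pi_plane.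
  rewrite e memv_pi_plane /= -em => /eqP/(mulfI m0).
  by rewrite expnS expn1 exprM => /(expr_card_inj)/esym.
have : ({:L} <= 1)%VS.
  apply/subvP => x _; have [a ->] := alg_fixed (fixq x).
  by rewrite rpredZ ?mem1v.
by move/dimvS; rewrite dimL dimv1.
Qed.

End Cubic.

(** * Transfer along the collineation and count of the planes *)

Theorem theorem2 (q : nat) (F : finFieldType) (hq : #|F| = q)
    (L : fieldExtType F) (hL : \dim {:L} = 3%N)
    (phi : {vspace L * L} -> {vspace L * L}) (hphi : collineation phi)
    (f : F) (hf : f != 0)
    (X Y Z : set {vspace L * L})
    (hX : X = phi @` andre_set L 0 f)
    (hY : Y = phi @` andre_set L 1 f)
    (hZ : Z = phi @` andre_set L 2 f) :
  [set U | is_plane U /\ forall W, X W -> meet_in_one_point U W] = Y `|` Z /\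
  [set U | is_plane U /\ forall W, X W -> meet_in_one_point U W]
    #= `I_(2 * (q ^ 2 + q + 1)).
Proof.
have norm_neq0 m : cubic_norm m = f%:A -> m != 0.
  apply: contra_eq_neq => ->; rewrite /cubic_norm expr0n addn1.
  by rewrite eq_sym scaler_eq0 oner_eq0 orbF.
have eqYZ : [set U | is_plane U /\ forall W, X W -> meet_in_one_point U W] = Y `|` Z.
  apply/seteqP; split=> U /=.
    (* The inverse collineation pulls U back to a transversal plane of the model. *)
    case=> dimU meetU; have [psi [phiK psiK psi_col]] := collineation_inv hphi.
    have [|m mN|i [b [i12 Nb Ub]]] := @transversal_plane_twist F L hL f (psi U) hf.
    - by rewrite collineation_dim.
    - rewrite -meet_in_one_pointP -(phiK (pi_plane 0 m)).
      apply: collineation_meet => //; apply: meetU; rewrite hX.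
      by exists (pi_plane 0 m) => //; exists m; rewrite norm_neq0.
    have Ui : (phi @` andre_set L i f) U.
      by exists (pi_plane i b); rewrite -?Ub ?psiK //; exists b; rewrite norm_neq0.
    by move: i12 Ui; rewrite !inE hY hZ => /orP[] /eqP ->; [left|right].
  move=> YZU; have [i i12 [_ [b [b0 Nb ->]] <-]] : exists2 i, i \in [:: 1; 2]%N &
      (phi @` andre_set L i f) U.
    by case: YZU; rewrite ?hY ?hZ; [exists 1%N | exists 2%N].
  split=> [|W]; first by rewrite /is_plane collineation_dim ?dim_pi_plane.
  rewrite hX => -[_ [m [m0 Nm ->]] <-]; apply: collineation_meet => //.
  by apply/meet_in_one_pointP; rewrite dim_cap_pi_plane // Nb.
split=> //; rewrite eqYZ.
have [rs [rs_uniq rs_size mem_rs]] := cubic_norm_fiber hL hf.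
have phi_inj := bij_inj (proj1 hphi).
(* The list runs over both twists and one norm fibre, so it has 2(q^2+q+1) entries, distinct because
   [phi] is injective. *)
pose s := [seq phi (pi_plane i m) | i <- [:: 1; 2]%N, m <- rs].
have s_uniq : uniq s.
  apply: allpairs_uniq => //.
  move=> x y /allpairsP[p [p1 p2 ->]] /allpairsP[p' [p1' p2' ->]] /= /phi_inj.
  case: p p' p1 p2 p1' p2' => [i m] [j m'] /=; rewrite !mem_rs !inE.
  move=> i12 /eqP/norm_neq0 m0 j12 /eqP/norm_neq0 m0'.
  case/orP: i12 => /eqP->; case/orP: j12 => /eqP-> e.
  - by rewrite (pi_plane_inj e).
  - by have := pi_plane1_neq2 hL m0 e.
  - by have := pi_plane1_neq2 hL m0' (esym e).
  - by rewrite (pi_plane_inj e).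
suff -> : Y `|` Z = [set` s].
  by have := card_eq_seq s_uniq; rewrite size_allpairs rs_size hq.
apply/seteqP; split=> U /=.
  move=> YZU; have [i i12 [_ [b [b0 Nb ->]] <-]] : exists2 i, i \in [:: 1; 2]%N &
      (phi @` andre_set L i f) U.
    by case: YZU; rewrite ?hY ?hZ; [exists 1%N | exists 2%N].
  by apply: allpairs_f => //; rewrite mem_rs Nb.
case/allpairsP => -[i m] /= [i12]; rewrite mem_rs => /eqP Nm ->.
have : (phi @` andre_set L i f) (phi (pi_plane i m)).
  by exists (pi_plane i m) => //; exists m; rewrite norm_neq0.
by move: i12; rewrite !inE hY hZ => /orP[] /eqP -> ; [left|right].
Qed.
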